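(* For a Noetherian cancellative monoid $A$ and an ideal $I$ of $A$, set $I^{tight}:=\{x\in A\mid \exists\,0\neq a\in A\text{ such that }ax^n\in I^{[n]}\text{ for all }n\gg0\}$, where $I^{[n]}:=\{bx^n\mid b\in A,\ x\in I\}$. Then: (1) $I\mapsto I^{tight}$ defines a closure operation on the collection of all ideals of $A$ (the tight closure operation). (2) Tight closure is persistent on the subcategory $\mathcal{M}$ of Noetherian cancellative monoids whose morphisms have zero kernel.
   Context: A monoid means a commutative monoid, written multiplicatively, with identity $1$ and a base point $0$ satisfying $0\cdot a=0$; morphisms preserve products, $1$ and $0$. An ideal $I\subseteq A$ is a subset containing $0$ with $IA\subseteq I$; it is generated by $Y\subseteq I$ if every $x\in I$ is $ay$ with $a\in A$, $y\in Y$. A monoid is Noetherian if all its ideals are finitely generated, and cancellative if for $a,b,c\in A$ with $a\ne0$, $ab=ac$ implies $b=c$. A morphism $\phi$ has zero kernel if $\phi(a)=0$ implies $a=0$. ''For all $n\gg0$'' means for all sufficiently large $n\in\mathbb{N}$. A closure operation on the set of ideals of $A$ is a map $I\mapsto I^{cl}$ from this set to itself with $I\subseteq I^{cl}$; $I\subseteq J\Rightarrow I^{cl}\subseteq J^{cl}$; $(I^{cl})^{cl}=I^{cl}$. A closure operation $cl$ defined on the ideals of all monoids in a subcategory $\mathcal{M}$ of monoids is persistent on $\mathcal{M}$ if for every morphism $\phi:A\to B$ in $\mathcal{M}$ and every ideal $I$ of $A$, $\phi(I^{cl})B\subseteq(\phi(I)B)^{cl}$.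
   Formalization: In (1) the monoid A is assumed to satisfy 1 ≠ 0: in the trivial monoid no a ≠ 0 exists, so the tight closure of {0} is empty and (1) fails. *)

(* Defs.v *)
From HB Require Import structures.
From mathcomp Require Import all_boot.
From mathcomp Require Import boolp classical_sets functions cardinality filter.

Set Implicit Arguments.
Unset Strict Implicit.
Unset Printing Implicit Defensive.

Import Algebra.

Local Open Scope classical_set_scope.
Local Open Scope group_scope.

(* [1 <> 0] is not an axiom: the trivial monoid is a [pcmonoidType]. *)
HB.mixin Record Monoid_isPointedCom A of Monoid A := {
  zerog : A;
  pcmulC : commutative (@mul A);
  pcmul0 : left_zero zerog (@mul A)
}.

#[short(type="pcmonoidType")]
HB.structure Definition PCMonoid := {A of Monoid A & Monoid_isPointedCom A}.

Notation "0" := (@zerog _) : group_scope.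

HB.mixin Record isZeroPreserving (A B : pcmonoidType) (f : A -> B) := {
  pcmorph0 : f 0 = 0
}.

#[short(type="pcmorphism")]
HB.structure Definition PCMorphism (A B : pcmonoidType) :=
  {f of @UMagmaMorphism A B f & isZeroPreserving A B f}.

Section MorphismInstances.
Variables A B C : pcmonoidType.

Fact idfun_pcmorph0 : @idfun A 0 = 0.
Proof. by []. Qed.

HB.instance Definition _ := isZeroPreserving.Build A A idfun idfun_pcmorph0.

Variables (g : pcmorphism B C) (f : pcmorphism A B).

Fact comp_pcmorph0 : (g \o f) 0 = 0.
Proof. by rewrite /= !pcmorph0. Qed.

HB.instance Definition _ := isZeroPreserving.Build A C (g \o f) comp_pcmorph0.

End MorphismInstances.

Section Ideals.
Variable A : pcmonoidType.
Implicit Types I J Y : set A.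

Definition ideal I := I 0 /\ forall x a, I x -> I (x * a).

Definition generated_by Y I :=
  Y `<=` I /\ forall x, I x -> exists a y, Y y /\ x = a * y.

Definition noetherian :=
  forall I, ideal I -> exists2 Y, finite_set Y & generated_by Y I.

Definition cancellative :=
  forall a b c : A, a <> 0 -> a * b = a * c -> b = c.

(* A self-map of the set of ideals is a self-map of [set A] that sends ideals
   to ideals; its values off the ideals are irrelevant. *)
Definition closure_operation (cl : set A -> set A) :=
  [/\ forall I, ideal I -> ideal (cl I),
      forall I, ideal I -> I `<=` cl I,
      forall I J, ideal I -> ideal J -> I `<=` J -> cl I `<=` cl J &
      forall I, ideal I -> cl (cl I) = cl I].

Definition frobenius_power I n : set A :=
  [set b * x ^+ n | b in setT & x in I].

(* In the trivial monoid this is empty, hence not even an ideal. *)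
Definition tight_closure I : set A :=
  [set x | exists a : A, a <> 0 /\
     \forall n \near \oo, frobenius_power I n (a * x ^+ n)].

End Ideals.

Arguments noetherian : clear implicits.
Arguments cancellative : clear implicits.

(* For an ideal [I] this is the ideal usually written phi(I)B. *)
Definition extension (A B : pcmonoidType) (phi : A -> B) (S : set A) : set B :=
  [set phi x * b | x in S & b in setT].

Definition zero_kernel (A B : pcmonoidType) (phi : A -> B) :=
  forall a, phi a = 0 -> a = 0.

Record subcategory := Subcategory {
  in_obj : pcmonoidType -> Prop;
  in_hom : forall A B : pcmonoidType, pcmorphism A B -> Prop;
  in_hom_id : forall A : pcmonoidType, in_obj A -> in_hom (@idfun A);
  in_hom_comp : forall (A B C : pcmonoidType)
    (g : pcmorphism B C) (f : pcmorphism A B),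
    in_obj A -> in_obj B -> in_obj C ->
    in_hom g -> in_hom f -> in_hom (g \o f)
}.

Definition persistent (M : subcategory)
    (cl : forall A : pcmonoidType, set A -> set A) :=
  forall A B : pcmonoidType, in_obj M A -> in_obj M B ->
  forall phi : pcmorphism A B, in_hom M phi ->
  forall I : set A, ideal I ->
    extension phi (cl A I) `<=` cl B (extension phi I).

Definition noeth_canc (A : pcmonoidType) := noetherian A /\ cancellative A.

Definition has_zero_kernel (A B : pcmonoidType) (phi : pcmorphism A B) :=
  zero_kernel phi.

Fact zero_kernel_id (A : pcmonoidType) :
  noeth_canc A -> has_zero_kernel (@idfun A).
Proof. by move=> _ a. Qed.

Fact zero_kernel_comp (A B C : pcmonoidType)
    (g : pcmorphism B C) (f : pcmorphism A B) :
  noeth_canc A -> noeth_canc B -> noeth_canc C ->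
  has_zero_kernel g -> has_zero_kernel f -> has_zero_kernel (g \o f).
Proof. by move=> _ _ _ g0 f0 a /= /g0 /f0. Qed.

Definition noeth_canc_cat : subcategory :=
  Subcategory zero_kernel_id zero_kernel_comp.

(* Main.v *)
Require Import Defs.
From mathcomp Require Import all_boot.
From mathcomp Require Import boolp classical_sets.
From mathcomp Require Import filter cardinality.

Local Open Scope group_scope.

(** Everything except idempotence is a direct manipulation of a witness
    equation [a * x ^+ n = b * y ^+ n]: multiply it, enlarge the ideal
    containing [y], or push it forward along a morphism.  Zero kernel is what
    keeps the multiplier [a] nonzero in the last case, hence persistence.

    Idempotence needs a multiplier that is uniform in [y].  If
    [a * x ^+ n = b * y ^+ n] with [y] in the tight closure of [I], then [y]
    depends on [n], and so does the multiplier testifying to its membership.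
    As the monoid is Noetherian, the tight closure of [I] is generated by
    finitely many elements; the product of their multipliers, nonzero because
    a cancellative monoid has no zero divisors, serves all of them at once
    ([tight_closure_common_multiplier]).  It therefore multiplies the whole
    [n]-th Frobenius power of the tight closure into that of [I] for large [n]
    ([tight_closure_multiplier]), which absorbs the dependence on [n]. *)

Section TightClosure.
Context {A : pcmonoidType}.
Implicit Types (I J Y : set A) (a b c x y : A) (n : nat).

Local Open Scope classical_set_scope.

Lemma expgMC x y n : (x * y) ^+ n = x ^+ n * y ^+ n.
Proof. exact/expgMn/pcmulC. Qed.

Lemma cancellative_mul_neq0 a b :
  cancellative A -> a <> 0 -> b <> 0 -> a * b <> 0.
Proof.
move=> canc a0 b0 ab0; apply: b0; apply: (canc a) => //.
by rewrite ab0 pcmulC pcmul0.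
Qed.

Lemma frobenius_power_expg I n x : I x -> frobenius_power I n (x ^+ n).
Proof. by move=> Ix; exists 1 => //; exists x; rewrite ?mul1g. Qed.

Lemma frobenius_powerMl I n a x :
  frobenius_power I n x -> frobenius_power I n (a * x).
Proof.
by move=> [b _ [y Iy <-]]; exists (a * b) => //; exists y; rewrite ?mulgA.
Qed.

Lemma frobenius_powerS I J n :
  I `<=` J -> frobenius_power I n `<=` frobenius_power J n.
Proof. by move=> IJ _ [b _ [y /IJ Jy <-]]; exists b => //; exists y. Qed.

Lemma tight_closureS I J : I `<=` J -> tight_closure I `<=` tight_closure J.
Proof.
move=> IJ x [a [a0 aI]]; exists a; split=> //.
by apply: filterS aI => n; apply: frobenius_powerS.
Qed.

Lemma sub_tight_closure I : (1 : A) <> 0 -> I `<=` tight_closure I.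
Proof.
move=> one_neq0 x Ix; exists 1; split=> //.
by apply: nearW => n; rewrite mul1g; apply: frobenius_power_expg.
Qed.

Lemma tight_closure_ideal I :
  (1 : A) <> 0 -> ideal I -> ideal (tight_closure I).
Proof.
move=> one_neq0 [I0 _]; split; first exact: sub_tight_closure I0.
move=> x b [a [a0 aI]]; exists a; split=> //.
apply: filterS aI => n aI.
by rewrite expgMC mulgA pcmulC; apply: frobenius_powerMl.
Qed.

(** The product of the individual multipliers works, a multiple of a
    multiplier being again one. *)
Lemma tight_closure_common_multiplier I Y :
  cancellative A -> (1 : A) <> 0 -> finite_set Y -> Y `<=` tight_closure I ->
  exists2 c, c <> 0 & \forall n \near \oo,
    forall y, Y y -> frobenius_power I n (c * y ^+ n).
Proof.
move=> canc one_neq0 /finite_seqP[s ->{Y}].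
elim: s => [|z s IHs] clI; first by exists 1 => //; apply: nearW.
have [c c0 cI] : exists2 c, c <> 0 & \forall n \near \oo,
    forall y, y \in s -> frobenius_power I n (c * y ^+ n).
  by apply: IHs => y /= ys; apply: clI; rewrite /= inE ys orbT.
have [a [a0 aI]] : tight_closure I z by apply: clI; rewrite /= inE eqxx.
exists (c * a); first exact: cancellative_mul_neq0.
apply: filterS2 cI aI => n cI aI y /=; rewrite inE => /predU1P[->|ys].
  by rewrite -mulgA; apply: frobenius_powerMl.
by rewrite (pcmulC c) -mulgA; apply/frobenius_powerMl/cI.
Qed.

(** A single nonzero [c] plays, for large [n], the role of all the multipliers
    of the elements of the tight closure: it suffices to treat generators,
    since the [n]-th power of [r * y] is a multiple of that of [y]. *)
Lemma tight_closure_multiplier I :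
  noetherian A -> cancellative A -> (1 : A) <> 0 -> ideal I ->
  exists2 c, c <> 0 & \forall n \near \oo,
    forall z, frobenius_power (tight_closure I) n z ->
      frobenius_power I n (c * z).
Proof.
move=> noeth canc one_neq0 idI.
have [Y finY [YI genY]] := noeth _ (tight_closure_ideal I one_neq0 idI).
have [c c0 cI] := tight_closure_common_multiplier I Y canc one_neq0 finY YI.
exists c => //; apply: filterS cI => n cI _ [b _ [x clx <-]].
have [r [y [Yy ->]]] := genY x clx.
have -> : c * (b * (r * y) ^+ n) = b * r ^+ n * (c * y ^+ n).
  by rewrite expgMC !mulgA (pcmulC c) -(mulgA b) (pcmulC c) !mulgA.
exact/frobenius_powerMl/cI.
Qed.

Lemma tight_closure_idem I :
  noetherian A -> cancellative A -> (1 : A) <> 0 -> ideal I ->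
  tight_closure (tight_closure I) = tight_closure I.
Proof.
move=> noeth canc one_neq0 idI; apply/seteqP; split; last first.
  exact: sub_tight_closure.
move=> x [a [a0 acl]].
have [c c0 cI] := tight_closure_multiplier I noeth canc one_neq0 idI.
exists (c * a); split; first exact: cancellative_mul_neq0.
by apply: filterS2 cI acl => n cI acl; rewrite -mulgA; apply: cI.
Qed.

Lemma tight_closure_closure_operation :
  noetherian A -> cancellative A -> (1 : A) <> 0 ->
  closure_operation (@tight_closure A).
Proof.
move=> noeth canc one_neq0; split.
- by move=> I; apply: tight_closure_ideal.
- by move=> I _; apply: sub_tight_closure.
- by move=> I J _ _; apply: tight_closureS.
- by move=> I; apply: tight_closure_idem.
Qed.

End TightClosure.

Section Extension.
Context {A B : pcmonoidType} (phi : pcmorphism A B).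
Implicit Type I : set A.

Local Open Scope classical_set_scope.

Lemma frobenius_power_extension I n x :
  frobenius_power I n x -> frobenius_power (extension phi I) n (phi x).
Proof.
move=> [b _ [y Iy <-]]; rewrite gmulfM gmulfXn.
apply/frobenius_powerMl/frobenius_power_expg.
by exists y => //; exists 1; rewrite ?mulg1.
Qed.

Lemma extension_tight_closure I :
  zero_kernel phi ->
  extension phi (tight_closure I) `<=` tight_closure (extension phi I).
Proof.
move=> ker0 _ [x [a [a0 aI]] [b _ <-]].
exists (phi a); split; first by move=> /ker0.
apply: filterS aI => n /frobenius_power_extension.
rewrite gmulfM gmulfXn expgMC mulgA (pcmulC _ (b ^+ n)).
exact: frobenius_powerMl.
Qed.

End Extension.

Theorem proposition4p7 :
  (forall A : pcmonoidType,
     noetherian A -> cancellative A -> (1 : A) <> 0 ->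
     closure_operation (@tight_closure A)) /\
  persistent noeth_canc_cat tight_closure.
Proof.
split; first by move=> A; apply: tight_closure_closure_operation.
by move=> A B _ _ phi ker0 I _; apply: extension_tight_closure.
Qed.
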